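(* Let $K$ be a field, let $x$ and $y$ be disjoint finite lists of indeterminates, and let $f\in K[x]$, $g\in K[y]$. Let $X_1$ and $X_2$ be $3$-matrix factorizations of $f$ of the same size, and let $X'$ be a $3$-matrix factorization of $g$. Then there are identities (1) $(X_1\oplus X_2)\,\overline{\otimes}_3\,X'=(X_1\,\overline{\otimes}_3\,X')\oplus(X_2\,\overline{\otimes}_3\,X')$; (2) $X'\,\overline{\otimes}_3\,(X_1\oplus X_2)=(X'\,\overline{\otimes}_3\,X_1)\oplus(X'\,\overline{\otimes}_3\,X_2)$.
   Context: For a list of indeterminates $x$, $K(x)$ denotes the field of fractions of $K[x]$. Matrices over $K(x)$ or over $K(y)$ are regarded as matrices over $K(x,y)$. A $3$-matrix factorization of size $n$ of a polynomial $f\in K[x]$ is a triplet $(\phi,\psi,\theta)$ of $n\times n$ matrices with entries in $K(x)$ such that $\phi\psi\theta=fI_n$; similarly for other lists of indeterminates. The direct sum of two $3$-matrix factorizations of the same polynomial is formed by block-diagonal matrices in each component: $(\phi_1,\psi_1,\theta_1)\oplus(\phi_2,\psi_2,\theta_2)=\left(\begin{bmatrix}\phi_1&0\\0&\phi_2\end{bmatrix},\begin{bmatrix}\psi_1&0\\0&\psi_2\end{bmatrix},\begin{bmatrix}\theta_1&0\\0&\theta_2\end{bmatrix}\right)$. The multiplicative tensor product of $3$-matrix factorizations of polynomials in disjoint lists of indeterminates is $(\phi,\psi,\theta)\,\overline{\otimes}_3\,(\phi',\psi',\theta')=(\phi\otimes\phi',\psi\otimes\psi',\theta\otimes\theta')$,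 where $\otimes$ is the standard tensor (Kronecker) product of matrices. If the factors have sizes $n$ and $m$ and $L=K(x,y)$, each component is regarded as an endomorphism of $L^n\otimes_L L^m$. *)

(* Defs.v *)
From HB Require Import structures.
From mathcomp Require Import all_boot all_algebra fraction.
From mathcomp.multinomials Require Import mpoly.
From mathcomp Require Import mxtens.

Set Implicit Arguments.
Unset Strict Implicit.
Unset Printing Implicit Defensive.

Import GRing.Theory.
Local Open Scope ring_scope.

(* ratfun K n is K(x) for a list x of n indeterminates.  For disjoint lists x
   and y of lengths r and s, K(x,y) is ratfun K (r + s): the indeterminates x
   are the first r ones and y the last s ones. *)
Notation ratfun K n := {fraction {mpoly K[n]}}.

Definition fracmap (A B : idomainType) (h : A -> B) (u : {fraction A}) :
    {fraction B} :=
  FracField.tofrac (h \n_(repr u)) / FracField.tofrac (h \d_(repr u)).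

Section FracMap.
Variables (A B : idomainType) (h : {rmorphism A -> B}).
Hypothesis h_inj : injective h.
Local Notation "x %:F" := (FracField.tofrac x).

Lemma fracE (u : {fraction A}) : u = (\n_(repr u))%:F / (\d_(repr u))%:F.
Proof.
have d0 : (\d_(repr u))%:F != 0 :> {fraction A}.
  by rewrite tofrac_eq0 denom_ratioP.
apply: (mulIf d0); rewrite mulfVK //.
rewrite -{1}[u]reprK /FracField.tofrac; unlock.
rewrite -[_ * _]FracField.pi_mul.
apply/eqP; rewrite FracField.equivf_def /FracField.mulf.
by rewrite !numden_Ratio ?mulr1 ?oner_neq0 ?denom_ratioP // mulrC.
Qed.

Lemma fracmap_div (n d : A) : d != 0 -> fracmap h (n%:F / d%:F) = (h n)%:F / (h d)%:F.
Proof.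
move=> d0; rewrite /fracmap; set u := n%:F / d%:F.
have hnz z : z != 0 -> (h z)%:F != 0 :> {fraction B}.
  by move=> z0; rewrite tofrac_eq0 -(rmorph0 h) (inj_eq h_inj).
have := fracE u; rewrite {1}/u => /eqP.
rewrite eqr_div ?tofrac_eq0 ?denom_ratioP // -!tofracM tofrac_eq => /eqP e.
apply/eqP; rewrite eqr_div ?hnz ?denom_ratioP //.
by rewrite -!tofracM -!rmorphM e.
Qed.

Lemma fracmap_tofrac (p : A) : fracmap h p%:F = (h p)%:F.
Proof.
by rewrite -[p%:F]divr1 -tofrac1 fracmap_div ?oner_neq0 // rmorph1 tofrac1 divr1.
Qed.

Lemma fracmap_zmod_morphism : zmod_morphism (fracmap h).
Proof.
move=> u v; rewrite (fracE u) (fracE v).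
set a := \n_(repr u); set b := \d_(repr u); set c := \n_(repr v); set d := \d_(repr v).
have b0 : b != 0 := denom_ratioP _; have d0 : d != 0 := denom_ratioP _.
have fnz z : z != 0 -> z%:F != 0 :> {fraction A} by rewrite tofrac_eq0.
have hnz z : z != 0 -> (h z)%:F != 0 :> {fraction B}.
  by move=> z0; rewrite tofrac_eq0 -(rmorph0 h) (inj_eq h_inj).
rewrite -mulNr addf_div ?fnz // -tofracN -!tofracM -tofracD.
rewrite !fracmap_div ?mulf_neq0 // -mulNr addf_div ?hnz //.
by rewrite -!tofracN -!tofracM -!tofracD rmorphD !rmorphM rmorphN.
Qed.

Lemma fracmap_monoid_morphism : monoid_morphism (fracmap h).
Proof.
split; first by rewrite -tofrac1 fracmap_tofrac rmorph1 tofrac1.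
move=> u v; rewrite (fracE u) (fracE v).
set a := \n_(repr u); set b := \d_(repr u); set c := \n_(repr v); set d := \d_(repr v).
have b0 : b != 0 := denom_ratioP _; have d0 : d != 0 := denom_ratioP _.
rewrite mulf_div -!tofracM !fracmap_div ?mulf_neq0 //.
by rewrite mulf_div -!tofracM !rmorphM.
Qed.

End FracMap.

Section Embeddings.
Variables (K : fieldType) (r s : nat).

Definition polyx (p : {mpoly K[r]}) : {mpoly K[r + s]} :=
  p \mPo [tuple 'X_(lshift s i) | i < r].
Definition polyy (p : {mpoly K[s]}) : {mpoly K[r + s]} :=
  p \mPo [tuple 'X_(rshift r j) | j < s].

HB.instance Definition _ :=
  GRing.RMorphism.copy polyx (comp_mpoly [tuple 'X_(lshift s i) | i < r]).
HB.instance Definition _ :=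
  GRing.RMorphism.copy polyy (comp_mpoly [tuple 'X_(rshift r j) | j < s]).

Lemma comp_mpoly_cancel a b (ta : a.-tuple {mpoly K[b]}) (tb : b.-tuple {mpoly K[a]}) :
  (forall i, tnth ta i \mPo tb = 'X_i) ->
  cancel (comp_mpoly ta) (comp_mpoly tb).
Proof.
move=> tK p; rewrite -{2}[p]comp_mpoly_id.
rewrite ![comp_mpoly _ p]comp_mpolyEX raddf_sum /=; apply: eq_bigr => m _.
rewrite comp_mpolyZ !comp_mpolyX rmorph_prod /=; congr (_ *: _).
by apply: eq_bigr => i _; rewrite rmorphXn /= tK tnth_mktuple.
Qed.

Lemma polyx_inj : injective polyx.
Proof.
apply: (can_inj (g := comp_mpoly
  [tuple (if split k is inl i then 'X_i else 0) | k < r + s])).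
apply: comp_mpoly_cancel => i; rewrite tnth_mktuple comp_mpolyXU.
by rewrite -tnth_nth tnth_mktuple (unsplitK (inl i)).
Qed.

Lemma polyy_inj : injective polyy.
Proof.
apply: (can_inj (g := comp_mpoly
  [tuple (if split k is inr i then 'X_i else 0) | k < r + s])).
apply: comp_mpoly_cancel => i; rewrite tnth_mktuple comp_mpolyXU.
by rewrite -tnth_nth tnth_mktuple (unsplitK (inr i)).
Qed.

(* The inclusions of K(x) and K(y) in K(x,y). *)
Definition fracx : ratfun K r -> ratfun K (r + s) := fracmap polyx.
Definition fracy : ratfun K s -> ratfun K (r + s) := fracmap polyy.

HB.instance Definition _ := GRing.isZmodMorphism.Build _ _ fracx
  (fracmap_zmod_morphism polyx_inj).
HB.instance Definition _ := GRing.isMonoidMorphism.Build _ _ fracx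
  (fracmap_monoid_morphism polyx_inj).
HB.instance Definition _ := GRing.isZmodMorphism.Build _ _ fracy
  (fracmap_zmod_morphism polyy_inj).
HB.instance Definition _ := GRing.isMonoidMorphism.Build _ _ fracy
  (fracmap_monoid_morphism polyy_inj).

Lemma fracx_tofrac p : fracx (FracField.tofrac p) = FracField.tofrac (polyx p).
Proof. exact: (fracmap_tofrac polyx_inj). Qed.

Lemma fracy_tofrac p : fracy (FracField.tofrac p) = FracField.tofrac (polyy p).
Proof. exact: (fracmap_tofrac polyy_inj). Qed.

End Embeddings.

Arguments fracx K r s : clear implicits.
Arguments fracy K r s : clear implicits.

(* 3-matrix factorizations of size n of an element f of a ring R.  For a
   polynomial p in K[x] this is used with R = K(x) and f the image of p. *)
Record mf3 (R : comNzRingType) (n : nat) (f : R) := MF3 {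
  phi : 'M[R]_n;
  psi : 'M[R]_n;
  theta : 'M[R]_n;
  mf3P : phi *m psi *m theta = f%:M
}.

Lemma mf3_eq (R : comNzRingType) n (f : R) (X Y : mf3 n f) :
  phi X = phi Y -> psi X = psi Y -> theta X = theta Y -> X = Y.
Proof.
case: X Y => [a b c p] [a' b' c' p'] /= ea eb ec.
case: a' / ea p' => p'; case: b' / eb p' => p'; case: c' / ec p' => p'.
by rewrite (eq_irrelevance p p').
Qed.

Notation mfact3 n p := (mf3 n (FracField.tofrac p)).

Section Operations.

Lemma mf3_dsumP (R : comNzRingType) n1 n2 (f : R) (X1 : mf3 n1 f) (X2 : mf3 n2 f) :
  block_mx (phi X1) 0 0 (phi X2) *m block_mx (psi X1) 0 0 (psi X2)
    *m block_mx (theta X1) 0 0 (theta X2) = f%:M.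
Proof.
rewrite !mulmx_block !(mulmx0, mul0mx, addr0, add0r) !mf3P.
by rewrite -scalar_mx_block.
Qed.

Definition mf3_dsum (R : comNzRingType) n1 n2 (f : R)
    (X1 : mf3 n1 f) (X2 : mf3 n2 f) : mf3 (n1 + n2) f :=
  MF3 (mf3_dsumP X1 X2).

Lemma mf3_tensP (R : comNzRingType) n m (f g : R) (X : mf3 n f) (Y : mf3 m g) :
  (phi X *t phi Y) *m (psi X *t psi Y) *m (theta X *t theta Y) = (f * g)%:M.
Proof.
rewrite !tensmx_mul !mf3P; apply/matrixP => i j.
rewrite !mxE -mulr_natr -[g *+ _]mulr_natr mulrACA -natrM mulr_natr mulnb.
by rewrite -(can_eq (@mxtens_unindexK n m)) /=.
Qed.

Definition mf3_tens (R : comNzRingType) n m (f g : R)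
    (X : mf3 n f) (Y : mf3 m g) : mf3 (n * m) (f * g) :=
  MF3 (mf3_tensP X Y).

Lemma mf3_mapP (R S : comNzRingType) (h : {rmorphism R -> S}) n (f : R) (X : mf3 n f) :
  map_mx h (phi X) *m map_mx h (psi X) *m map_mx h (theta X) = (h f)%:M.
Proof. by rewrite -!map_mxM mf3P map_scalar_mx. Qed.

Definition mf3_map (R S : comNzRingType) (h : {rmorphism R -> S}) n (f : R)
    (X : mf3 n f) : mf3 n (h f) :=
  MF3 (mf3_mapP h X).

Lemma mf3_castP (R : comNzRingType) n m (e : n = m) (f : R) (X : mf3 n f) :
  castmx (e, e) (phi X) *m castmx (e, e) (psi X) *m castmx (e, e) (theta X) = f%:M.
Proof. by case: m / e; rewrite !castmx_id mf3P. Qed.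

Definition mf3_cast (R : comNzRingType) n m (e : n = m) (f : R)
    (X : mf3 n f) : mf3 m f :=
  MF3 (mf3_castP e X).

Lemma mf3_transportP (R : comNzRingType) n m (P : 'M[R]_(m, n)) (Q : 'M[R]_(n, m))
    (PQ : P *m Q = 1%:M) (QP : Q *m P = 1%:M) (f : R) (X : mf3 n f) :
  (P *m phi X *m Q) *m (P *m psi X *m Q) *m (P *m theta X *m Q) = f%:M.
Proof.
transitivity (P *m (phi X *m (Q *m P) *m psi X *m (Q *m P) *m theta X) *m Q).
  by rewrite !mulmxA.
by rewrite QP !mulmx1 mf3P mul_mx_scalar -scalemxAl PQ scalemx1.
Qed.

(* Conjugation of the three endomorphisms by one isomorphism P : R^n -> R^m
   with inverse Q. *)
Definition mf3_transport (R : comNzRingType) n m (P : 'M[R]_(m, n)) (Q : 'M[R]_(n, m))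
    (PQ : P *m Q = 1%:M) (QP : Q *m P = 1%:M) (f : R) (X : mf3 n f) : mf3 m f :=
  MF3 (mf3_transportP PQ QP X).

End Operations.

Section Distributivity.
Variable R : comNzRingType.

(* With the Kronecker convention (A *t B) = (a_ij B), the basis vectors
   e_i (x) e_j are ordered lexicographically, so that the canonical isomorphism
   (U1 (+) U2) (x) V = (U1 (x) V) (+) (U2 (x) V) has the identity matrix, up to
   the equation on dimensions. *)
Lemma distl_pure n1 n2 m (u1 : 'cV[R]_n1) (u2 : 'cV[R]_n2) (v : 'cV[R]_m) :
  castmx (mulnDl n1 n2 m, erefl) (col_mx u1 u2 *t v) = col_mx (u1 *t v) (u2 *t v).
Proof.
apply/matrixP => i j; rewrite castmxE cast_ord_id.
case: (mxtens_indexP j) => c d.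
case: (split_ordP i) => k ->; case: (mxtens_indexP k) => a b.
  have -> : cast_ord (esym (mulnDl n1 n2 m)) (lshift (n2 * m) (mxtens_index (a, b)))
    = mxtens_index (lshift n2 a, b) by apply: val_inj.
  by rewrite tensmxE !col_mxEu tensmxE.
have -> : cast_ord (esym (mulnDl n1 n2 m)) (rshift (n1 * m) (mxtens_index (a, b)))
  = mxtens_index (rshift n1 a, b).
  by apply: val_inj; rewrite /= mulnDl addnA.
by rewrite tensmxE !col_mxEd tensmxE.
Qed.

(* The canonical isomorphism V (x) (U1 (+) U2) -> (V (x) U1) (+) (V (x) U2) and
   its inverse, with components id (x) projection and id (x) injection.  In the
   lexicographic bases they are nontrivial permutation matrices. *)
Definition distr m n1 n2 : 'M[R]_(m * n1 + m * n2, m * (n1 + n2)) :=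
  col_mx ((1%:M : 'M_m) *t row_mx (1%:M : 'M_n1) (0 : 'M_(n1, n2)))
         ((1%:M : 'M_m) *t row_mx (0 : 'M_(n2, n1)) (1%:M : 'M_n2)).

Definition distr_inv m n1 n2 : 'M[R]_(m * (n1 + n2), m * n1 + m * n2) :=
  row_mx ((1%:M : 'M_m) *t col_mx (1%:M : 'M_n1) (0 : 'M_(n2, n1)))
         ((1%:M : 'M_m) *t col_mx (0 : 'M_(n1, n2)) (1%:M : 'M_n2)).

Lemma tensmx11 m n : (1%:M : 'M[R]_m) *t (1%:M : 'M[R]_n) = 1%:M.
Proof.
apply/matrixP => i j; rewrite !mxE -natrM mulnb.
by rewrite -(can_eq (@mxtens_unindexK m n)) /=.
Qed.

Lemma distrK m n1 n2 : distr m n1 n2 *m distr_inv m n1 n2 = 1%:M.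
Proof.
rewrite mul_col_row !tensmx_mul !mul_row_col !mulmx1 !(mulmx0, mul0mx).
by rewrite !addr0 add0r !tensmx0 !tensmx11 -scalar_mx_block.
Qed.

Lemma distr_invK m n1 n2 : distr_inv m n1 n2 *m distr m n1 n2 = 1%:M.
Proof.
rewrite mul_row_col !tensmx_mul !mul_col_row !mulmx1 !(mulmx0, mul0mx).
apply/matrixP => i j.
case: (mxtens_indexP i) => a b; case: (mxtens_indexP j) => c d.
rewrite -tensmx11 mxE !tensmxE -mulrDr; congr (_ * _).
rewrite (scalar_mx_block n1 n2 1).
case: (split_ordP b) => k ->; case: (split_ordP d) => l ->;
  by rewrite !(block_mxEul, block_mxEur, block_mxEdl, block_mxEdr) ?mxE ?addr0 ?add0r.
Qed.

Lemma distr_pure m n1 n2 (v : 'cV[R]_m) (u1 : 'cV[R]_n1) (u2 : 'cV[R]_n2) :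
  distr m n1 n2 *m (v *t col_mx u1 u2) = col_mx (v *t u1) (v *t u2).
Proof.
by rewrite mul_col_mx !tensmx_mul !mul_row_col !mul1mx !mul0mx addr0 add0r.
Qed.

End Distributivity.

(* Both sides of an identity V (x) (U1 (+) U2) = (V (x) U1) (+) (V (x) U2) are
   compared through the canonical isomorphism. *)
Definition mf3_distr (R : comNzRingType) m n1 n2 (f : R)
    (X : mf3 (m * (n1 + n2)) f) : mf3 (m * n1 + m * n2) f :=
  mf3_transport (@distrK R m n1 n2) (@distr_invK R m n1 n2) X.

(* Main.v *)
Require Import Defs.
From mathcomp Require Import all_boot all_algebra fraction.
From mathcomp.multinomials Require Import mpoly.
From mathcomp Require Import mxtens.

(** Both identities hold componentwise, since a factorization is determined by
    its three matrices, and each component is an instance of the distributivity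
    of the Kronecker product over block matrices.

    With the lexicographic order on the basis vectors e_i (x) e_j, the block
    decomposition of the left factor survives the product: the rows of A *t C
    for a stacked A are the rows coming from the top of A, followed by those
    coming from the bottom.  This is [tens_block_mx], where the only change is
    the equation (n1 + n2) * m = n1 * m + n2 * m on dimensions.  A block
    decomposition of the right factor is interleaved instead, and has to be
    sorted out by the canonical isomorphism [distr].  There the components of
    [distr] and [distr_inv] are identities tensored with projections and
    injections, so the mixed-product rule (A *t B) (C *t D) = AC *t BD extracts
    the blocks one by one: this is [distr_tens_block_mx].

    The inclusions of K(x) and K(y) in K(x,y) enter only as ring morphisms: they
    act entrywise and so commute with the formation of block matrices. *)

Import GRing.Theory.
Local Open Scope ring_scope.

Section BlockKronecker.
Variable R : comNzRingType.

Lemma tens_block_mx m1 m2 n1 n2 p q (A : 'M[R]_(m1, n1)) (B : 'M[R]_(m1, n2))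
    (C : 'M[R]_(m2, n1)) (D : 'M[R]_(m2, n2)) (V : 'M[R]_(p, q)) :
  castmx (mulnDl m1 m2 p, mulnDl n1 n2 q) (block_mx A B C D *t V)
    = block_mx (A *t V) (B *t V) (C *t V) (D *t V).
Proof.
(* The pair (a, b) has position a * k + b, so shifting a by k1 shifts the
   position by k1 * k. *)
have indexl k1 k2 k (a : 'I_k1) (b : 'I_k) :
    cast_ord (esym (mulnDl k1 k2 k)) (lshift (k2 * k) (mxtens_index (a, b)))
    = mxtens_index (lshift k2 a, b) by apply: val_inj.
have indexr k1 k2 k (a : 'I_k2) (b : 'I_k) :
    cast_ord (esym (mulnDl k1 k2 k)) (rshift (k1 * k) (mxtens_index (a, b)))
    = mxtens_index (rshift k1 a, b).
  by apply: val_inj; rewrite /= mulnDl addnA.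
apply/matrixP => i j; rewrite castmxE /=.
case: (split_ordP i) => {}i ->; case: (split_ordP j) => {}j ->;
  case: (mxtens_indexP i) => a b; case: (mxtens_indexP j) => c d;
  by rewrite ?indexl ?indexr
       !(block_mxEul, block_mxEur, block_mxEdl, block_mxEdr, tensmxE).
Qed.

(** Conjugating by the two canonical isomorphisms cuts V *t M into its four
    compressions (id *t projection) (V *t M) (id *t injection). *)
Lemma distr_tens_block_mx m1 m2 n1 n2 p q (A : 'M[R]_(m1, n1))
    (B : 'M[R]_(m1, n2)) (C : 'M[R]_(m2, n1)) (D : 'M[R]_(m2, n2))
    (V : 'M[R]_(p, q)) :
  distr R p m1 m2 *m (V *t block_mx A B C D) *m distr_inv R q n1 n2
    = block_mx (V *t A) (V *t B) (V *t C) (V *t D).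
Proof.
rewrite /distr /distr_inv mul_col_mx mul_col_row !tensmx_mul !mul_row_block.
by rewrite !mul_row_col !mul1mx !mulmx1 !(mul0mx, mulmx0, addr0, add0r).
Qed.

End BlockKronecker.

Theorem proposition5p3 (K : fieldType) (r s : nat)
    (f : {mpoly K[r]}) (g : {mpoly K[s]}) (n m : nat)
    (X1 X2 : mfact3 n f) (X' : mfact3 m g) :
  mf3_cast (mulnDl n n m)
      (mf3_tens (mf3_map (fracx K r s) (mf3_dsum X1 X2)) (mf3_map (fracy K r s) X'))
    = mf3_dsum (mf3_tens (mf3_map (fracx K r s) X1) (mf3_map (fracy K r s) X'))
               (mf3_tens (mf3_map (fracx K r s) X2) (mf3_map (fracy K r s) X'))
  /\
  mf3_distr
      (mf3_tens (mf3_map (fracy K r s) X') (mf3_map (fracx K r s) (mf3_dsum X1 X2)))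
    = mf3_dsum (mf3_tens (mf3_map (fracy K r s) X') (mf3_map (fracx K r s) X1))
               (mf3_tens (mf3_map (fracy K r s) X') (mf3_map (fracx K r s) X2)).
Proof.
split; apply: mf3_eq => /=; rewrite map_block_mx !map_mx0.
1-3: by rewrite tens_block_mx !tens0mx.
all: by rewrite distr_tens_block_mx !tensmx0.
Qed.
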